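(* Let $\big(G(L)=(V,E,L),s,t,c\big)$ be a temporal flow network in which every node has an unbounded (infinite) buffer. Then the maximum value $\max_f v(f)$ of a temporal flow in $G(L)$ equals the minimum capacity of a (minimal) temporal cut separating $s$ and $t$.
   Context: A temporal graph $G(L)=(V,E,L)$ consists of a finite directed graph $G=(V,E)$ and a labelling assigning to each edge $e$ a finite set $L_e\subseteq\mathbb{N}$ of positive integer labels (days of availability). A time edge is a triple $(u,v,l)$ (also $(e,l)$) with $e=(u,v)\in E$, $l\in L_e$; $E_L$ is the set of time edges. A journey from $u$ to $v$ is a sequence of time edges $(u,u_1,l_1),(u_1,u_2,l_2),\dots,(u_{k-1},v,l_k)$ with $l_1<l_2<\dots<l_k$. The network has source $s$ and sink $t$ (no edge enters $s$, none leaves $t$), and edge capacities $c(e)>0$. A temporal flow consists of non-negative reals $f(e,l)$ and buffer contents $b_u^-(l),b_u^\mu(l),b_u^+(l)\ge 0$ for nodes $u$ and $l\in L_R(u)=\{0\}\cup\bigcup_{e \text{ incident to } u}L_e$, such that $0\le f(e,l)\le c(e)$, $f(e,l)=0$ if $l=0$ or $l\notin L_e$, an infinite amount of flow is available at $s$ at time $0$, and for every $v\ne s$: $b_v^\pm(0)=b_v^\mu(0)=0$, and for each label $l>0$ in $L_R(v)$, $b_v^-(l)=b_v^+(l_{prev})$ ($l_{prev}$ the previous element of $L_R(v)$), $b_v^\mu(l)=b_v^-(l)-\sum_{e \text{ out of } v}f(e,l)$, $b_v^+(l)=b_v^\mu(l)+\sum_{e\text{ into }v}f(e,l)$. The value $v(f)$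 is $b_t^+(l_{max})$, $l_{max}$ the maximum label. A temporal cut is a set $S$ of time edges whose removal leaves no $s\to t$ journey; it is minimal if no proper subset is a temporal cut; its capacity is $c(S)=\sum_{(e,l)\in S}c(e)$. *)

(* Defs.v *)
From mathcomp Require Export all_boot all_order all_algebra finmap.
From mathcomp Require Export mathcomp_extra boolp classical_sets reals constructive_ereal.
Set Implicit Arguments.
Unset Strict Implicit.
Unset Printing Implicit Defensive.
Import Order.TTheory GRing.Theory Num.Theory.
Local Open Scope ring_scope.

(* Edges are ordered pairs of nodes, so [e.1] is the tail and [e.2] the head.
   The values of [labels] and [cap] outside [edges] are never used.  A buffer
   capacity [+oo] means that the node has an unbounded buffer. *)
Record temporal_network (R : realType) (V : finType) := TemporalNetwork {
  edges : {set V * V};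
  labels : V * V -> {fset nat};
  source : V;
  sink : V;
  cap : V * V -> R;
  buffer_cap : V -> \bar R;
  labels_gt0 : forall e l, e \in edges -> l \in labels e -> (0 < l)%N;
  source_neq_sink : source != sink;
  source_no_in : forall u, (u, source) \notin edges;
  sink_no_out : forall v, (sink, v) \notin edges;
  cap_gt0 : forall e, e \in edges -> 0 < cap e
}.

Definition time_edge (V : finType) : Type := (V * V * nat)%type.

Definition time_edges (R : realType) (V : finType) (N : temporal_network R V) :
    {fset V * V * nat} :=
  (\bigcup_(e in edges N) [fset (e, l) | l in labels N e])%fset.

Definition max_label (R : realType) (V : finType) (N : temporal_network R V) : nat :=
  (\max_(x <- time_edges N) x.2)%N.

Definition node_labels (R : realType) (V : finType) (N : temporal_network R V)
    (u : V) : {fset nat} :=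
  (0%N |` \bigcup_(e in edges N | (e.1 == u) || (e.2 == u)) labels N e)%fset.

(* For [0 < l] the set ranged over contains 0, so this is the largest element
   of [node_labels N u] below [l]. *)
Definition prev_label (R : realType) (V : finType) (N : temporal_network R V)
    (u : V) (l : nat) : nat :=
  (\max_(k <- node_labels N u | k < l) k)%N.

(* Buffers are only defined at the labels in [node_labels N u] and keep their
   content between consecutive ones: the content of the buffer of [u] at the
   end of day [d] is the one recorded at the label [last_label N u d], which is
   [d] itself when [d \in node_labels N u]. *)
Definition last_label (R : realType) (V : finType) (N : temporal_network R V)
    (u : V) (d : nat) : nat :=
  (\max_(k <- node_labels N u | k <= d) k)%N.

(* [buf_minus], [buf_mu] and [buf_plus] are b^-, b^mu and b^+.  They are
   extended-real valued because the source holds an infinite amount of flow. *)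
Record pre_flow (R : realType) (V : finType) := PreFlow {
  flow : V * V -> nat -> R;
  buf_minus : V -> nat -> \bar R;
  buf_mu : V -> nat -> \bar R;
  buf_plus : V -> nat -> \bar R
}.

Record is_temporal_flow (R : realType) (V : finType) (N : temporal_network R V)
    (f : pre_flow R V) : Prop := IsTemporalFlow {
  flow_cap : forall e l, e \in edges N -> 0 <= flow f e l <= cap N e;
  flow_day0 : forall e, e \in edges N -> flow f e 0 = 0;
  flow_unavailable : forall e l, e \in edges N -> l \notin labels N e ->
    flow f e l = 0;
  buf_bounds : forall u l, l \in node_labels N u ->
    [/\ (0 <= buf_minus f u l <= buffer_cap N u)%E,
        (0 <= buf_mu f u l <= buffer_cap N u)%E &
        (0 <= buf_plus f u l <= buffer_cap N u)%E];
  buf_source : buf_plus f (source N) 0 = +oo%E;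
  buf_day0 : forall v, v != source N ->
    [/\ buf_minus f v 0 = 0%E, buf_mu f v 0 = 0%E & buf_plus f v 0 = 0%E];
  buf_minusE : forall v l, v != source N -> l \in node_labels N v -> (0 < l)%N ->
    buf_minus f v l = buf_plus f v (prev_label N v l);
  buf_muE : forall v l, v != source N -> l \in node_labels N v -> (0 < l)%N ->
    buf_mu f v l =
      (buf_minus f v l - (\sum_(e in edges N | e.1 == v) flow f e l)%R%:E)%E;
  buf_plusE : forall v l, v != source N -> l \in node_labels N v -> (0 < l)%N ->
    buf_plus f v l =
      (buf_mu f v l + (\sum_(e in edges N | e.2 == v) flow f e l)%R%:E)%E
}.

Definition flow_value (R : realType) (V : finType) (N : temporal_network R V)
    (f : pre_flow R V) : \bar R :=
  buf_plus f (sink N) (last_label N (sink N) (max_label N)).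

Definition journey (V : finType) (A : {fset V * V * nat}) (u v : V)
    (p : seq (time_edge V)) : bool :=
  if p is x :: q then
    [&& all (fun y : time_edge V => y \in A) p, x.1.1 == u, (last x q).1.2 == v &
        path (fun y z : time_edge V => (y.1.2 == z.1.1) && (y.2 < z.2)%N) x q]
  else false.

Definition temporal_cut (R : realType) (V : finType) (N : temporal_network R V)
    (S : {fset V * V * nat}) : Prop :=
  (S `<=` time_edges N)%fset /\
  ~ exists p, journey (time_edges N `\` S)%fset (source N) (sink N) p.

Definition minimal_temporal_cut (R : realType) (V : finType)
    (N : temporal_network R V) (S : {fset V * V * nat}) : Prop :=
  temporal_cut N S /\ forall S', (S' `<` S)%fset -> ~ temporal_cut N S'.

Definition cut_capacity (R : realType) (V : finType) (N : temporal_network R V)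
    (S : {fset V * V * nat}) : R :=
  \sum_(x <- S) cap N x.1.

Definition is_maximum d (T : porderType d) (A : set T) (m : T) : Prop :=
  A m /\ ubound A m.

Definition is_minimum d (T : porderType d) (A : set T) (m : T) : Prop :=
  A m /\ lbound A m.

(* Main.v *)
(* In the static network whose nodes are the pairs (node, end of day), where
   holding flow from one day to the next costs more than all time edges, the
   static cuts of minimum weight consist of time edges and give temporal cuts,
   and static flows give temporal flows.

   Static max-flow min-cut: lower the arc capacities one by one, as far as the
   minimum cut weight allows, until every arc of positive capacity lies in a
   minimum cut.  By submodularity the capacities that remain balance at every
   node, i.e. they form a flow, of value the minimum cut weight. *)
Require Import Defs.
From mathcomp Require Import lra.
Set Implicit Arguments.
Unset Strict Implicit.
Unset Printing Implicit Defensive.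
Import Order.TTheory GRing.Theory Num.Theory.
Local Open Scope ring_scope.

(** * Static max-flow min-cut by tightening capacities *)

Section StaticNetwork.
Variables (R : realDomainType) (W E : finType).

Definition crosses (src dst : E -> W) (X : {set W}) (e : E) : bool :=
  (src e \in X) && (dst e \notin X).

Definition cut_weight (src dst : E -> W) (c : E -> R) (X : {set W}) : R :=
  \sum_(e | crosses src dst X e) c e.

Definition separates (s t : W) (X : {set W}) : bool := (s \in X) && (t \notin X).

(** No positive arc capacity can be lowered without some separating cut dropping below [m]. *)
Definition tight (src dst : E -> W) (s t : W) (c : E -> R) (m : R) : Prop :=
  [/\ forall e, 0 <= c e,
      forall X, separates s t X -> m <= cut_weight src dst c X &
      forall e, c e != 0 -> exists2 X : {set W}, separates s t X &
        crosses src dst X e /\ cut_weight src dst c X = m].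

Lemma cut_weightE src dst c X :
  cut_weight src dst c X = \sum_e (if crosses src dst X e then c e else 0).
Proof. exact: big_mkcond. Qed.

(** Checked arc by arc. The extra sum runs over the arcs from [X] minus [Y] to [Y] minus [X], which
    count for [X] but neither for the union nor for the intersection. *)
Lemma cut_weight_submod src dst c X Y : (forall e, 0 <= c e) ->
  cut_weight src dst c (X :|: Y) + cut_weight src dst c (X :&: Y)
  + \sum_(e | crosses src dst X e && crosses dst src Y e) c e
  <= cut_weight src dst c X + cut_weight src dst c Y.
Proof.
move=> c0; rewrite !cut_weightE [X in _ + X]big_mkcond -!big_split.
apply: ler_sum => e _; rewrite /crosses !inE; have := c0 e.
by case: (src e \in X); case: (dst e \in X);
  case: (src e \in Y); case: (dst e \in Y) => /=; lra.
Qed.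

(** Union and intersection both separate, so each weighs at least [m]; submodularity bounds their
    total by [2m], which leaves nothing for the extra sum. *)
Lemma min_cuts_uncross src dst s t c m X Y : (forall e, 0 <= c e) ->
  (forall Z, separates s t Z -> m <= cut_weight src dst c Z) ->
  separates s t X -> cut_weight src dst c X = m ->
  separates s t Y -> cut_weight src dst c Y = m ->
  [/\ separates s t (X :|: Y), cut_weight src dst c (X :|: Y) = m &
      forall e, crosses src dst X e -> crosses dst src Y e -> c e = 0].
Proof.
move=> c0 cm sX Xm sY Ym.
have [sU sI] : separates s t (X :|: Y) /\ separates s t (X :&: Y).
  move: sX sY; rewrite /separates !inE.
  by case: (s \in X); case: (s \in Y); case: (t \in X); case: (t \in Y).
have := cut_weight_submod src dst X Y c0; rewrite Xm Ym.
set r := \sum_(e | _) _ => sub.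
have r0 : 0 <= r by apply: sumr_ge0.
have := cm _ sU; have := cm _ sI => mI mU; split=> //; first lra.
move=> e eX eY; have : r = 0 by lra.
by move/psumr_eq0P => -> //; rewrite eX.
Qed.

Lemma tighten src dst s t c m : (forall e, 0 <= c e) ->
  (forall X, separates s t X -> m <= cut_weight src dst c X) ->
  exists2 c', tight src dst s t c' m & forall e, c' e <= c e.
Proof.
move=> c0 cm.
suff: forall r : seq E, exists c',
    [/\ forall e, 0 <= c' e, forall e, c' e <= c e,
        forall X, separates s t X -> m <= cut_weight src dst c' X &
        forall e, e \in r -> c' e != 0 -> exists2 X : {set W}, separates s t X &
          crosses src dst X e /\ cut_weight src dst c' X = m].
  move=> /(_ (enum E))[c' [c'0 c'c c'm tc']]; exists c' => //; split=> // e.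
  by apply: tc'; rewrite mem_enum.
elim=> [|e r [c' [c'0 c'c c'm tc']]]; first by exists c.
pose lower d x := if x == e then c' e - d else c' x.
have lowerE d X : cut_weight src dst (lower d) X =
    cut_weight src dst c' X - (if crosses src dst X e then d else 0).
  rewrite !cut_weightE (bigD1 e)//= [in RHS](bigD1 e)//= /lower eqxx.
  rewrite (eq_bigr (fun x => if crosses src dst X x then c' x else 0)).
    by case: ifP => _; lra.
  by move=> x /negbTE ->.
(* [d] is the smaller of [c' e] and the least excess over [m] among the separating cuts that [e]
   crosses, or [c' e] if it crosses none. *)
suff [d [d0 dc dm dt]] : exists d, [/\ 0 <= d, d <= c' e,
    forall X, separates s t X -> crosses src dst X e ->
      m + d <= cut_weight src dst c' X &
    c' e - d != 0 -> exists2 X, separates s t X &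
      crosses src dst X e /\ cut_weight src dst c' X = m + d].
  have lm X : separates s t X -> m <= cut_weight src dst (lower d) X.
    move=> sX; rewrite lowerE; case: ifP => [eX|_]; last by rewrite subr0 c'm.
    by have := dm X sX eX; lra.
  exists (lower d); split=> // [x|x|x].
  - by rewrite /lower; case: eqP => _ //; lra.
  - by rewrite /lower; case: eqP => [->|_ //]; have := c'c e; lra.
  - rewrite inE {1}/lower; case: eqP => [-> _ ce|_ /= xr cx].
      have [X sX [eX Xm]] := dt ce; exists X => //; split=> //.
      by rewrite lowerE eX Xm; lra.
    (* A minimum cut found for an earlier arc stays minimum: lowering cannot raise its weight, and
       no separating cut falls below [m]. *)
    have [X sX [xX Xm]] := tc' _ xr cx; exists X => //; split=> //.
    apply/eqP; rewrite eq_le lm// andbT lowerE Xm.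
    by case: ifP => _; lra.
case: (pickP (fun X => separates s t X && crosses src dst X e)) => [X0 PX0|noX].
  pose P X := separates s t X && crosses src dst X e.
  case: (@arg_minP _ _ _ X0 P (cut_weight src dst c') PX0) => X /andP[sX eX] minX.
  have mX := c'm _ sX.
  have [le|lt] := leP (c' e) (cut_weight src dst c' X - m).
    exists (c' e); split=> // [Y sY eY|]; last by rewrite subrr eqxx.
    by have := minX Y; rewrite /P sY eY => /(_ isT); lra.
  exists (cut_weight src dst c' X - m); split=> //; [lra|lra| |].
    by move=> Y sY eY; have := minX Y; rewrite /P sY eY => /(_ isT); lra.
  by move=> _; exists X => //; split=> //; lra.
exists (c' e); split=> // [X sX eX|]; last by rewrite subrr eqxx.
by have := noX X; rewrite sX eX.
Qed.

(** A positive arc entering [X] would leave another minimum cut [Y], hence run from [Y] minus [X] to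
    [X] minus [Y], which uncrossing forbids. *)
Lemma tight_no_return src dst s t c m X : tight src dst s t c m ->
  separates s t X -> cut_weight src dst c X = m ->
  forall e, crosses dst src X e -> c e = 0.
Proof.
case=> c0 cm tc sX Xm e eX; apply/eqP; apply/negPn/negP => ce.
have [Y sY [eY Ym]] := tc e ce.
by move: ce; have [_ _ ->] := min_cuts_uncross c0 cm sY Ym sX Xm; rewrite ?eqxx.
Qed.

(* The largest minimum cut X avoiding v contains the tails of all arcs into v;
   compare its weight with that of X + v. *)
Lemma tight_in_le_out src dst s t c m v : tight src dst s t c m -> v != t ->
  \sum_(e | dst e == v) c e <= \sum_(e | src e == v) c e.
Proof.
case=> c0 cm tc vt.
pose P X := [&& separates s t X, v \notin X & cut_weight src dst c X == m].
case: (pickP P) => [X0 PX0|noP]; last first.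
  (* A positive arc into [v] would leave a minimum cut, and that cut would avoid [v]. *)
  rewrite big1 ?sumr_ge0// => e /eqP ev; apply/eqP; apply/negPn/negP => ce.
  have [X sX [/andP[_ eX] Xm]] := tc e ce.
  by have := noP X; rewrite /P sX Xm eqxx -ev eX.
case: (@arg_maxnP _ X0 P (fun X => #|X|) PX0) => X /and3P[sX vX /eqP Xm] maxX.
(* Uniting [X] with a minimum cut that [e] leaves gives a minimum cut still avoiding [v]; by
   maximality it equals [X]. *)
have tails e : c e != 0 -> dst e = v -> src e \in X.
  move=> ce ev; have [Y sY [/andP[eY eY'] Ym]] := tc e ce.
  have [sU Um _] := min_cuts_uncross c0 cm sY Ym sX Xm.
  have : P (Y :|: X) by rewrite /P sU Um inE negb_or vX -ev eY' eqxx.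
  move=> /maxX leX; have /eqP -> : X == Y :|: X.
    by rewrite eqEcard finset.subsetUr.
  by rewrite inE eY.
have sv : separates s t (v |: X).
  by move: sX; rewrite /separates !inE negb_or [t == v]eq_sym vt => /andP[-> ->]; rewrite orbT.
suff : cut_weight src dst c (v |: X) + \sum_(e | dst e == v) c e
       <= cut_weight src dst c X + \sum_(e | src e == v) c e.
  by have := cm _ sv; rewrite Xm; lra.
rewrite !cut_weightE [X in _ + X]big_mkcond [X in _ <= _ + X]big_mkcond -!big_split.
apply: ler_sum => e _; rewrite /crosses !inE /=; have := c0 e.
have [->|ce] := eqVneq (c e) 0; first by rewrite !if_same; lra.
have [ev|_] := eqVneq (dst e) v; last first.
  by case: (src e \in X); case: (dst e \in X); case: (src e == v) => /=; lra.
by rewrite (tails e ce ev) ev vX andbF /=; case: (src e == v); lra.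
Qed.

Lemma cut_weight_rev src dst c X :
  cut_weight dst src c (~: X) = cut_weight src dst c X.
Proof. by apply: eq_bigl => e; rewrite /crosses !inE negbK andbC. Qed.

(** Reversing arcs and complementing cuts swaps [s] and [t], so that [tight_in_le_out] also bounds
    outflow by inflow. *)
Lemma tight_rev src dst s t c m :
  tight src dst s t c m -> tight dst src t s c m.
Proof.
case=> c0 cm tc; split=> // [X sX|e ce].
  rewrite -cut_weight_rev cm//.
  by move: sX; rewrite /separates !inE negbK andbC.
have [X sX [eX Xm]] := tc e ce; exists (~: X).
  by move: sX; rewrite /separates !inE negbK andbC.
rewrite cut_weight_rev; split=> //.
by move: eX; rewrite /crosses !inE negbK andbC.
Qed.

Theorem max_flow_min_cut src dst s t (c : E -> R) :
  s != t -> (forall e, 0 <= c e) ->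
  exists f X,
    [/\ forall e, 0 <= f e <= c e,
        forall v, v != s -> v != t ->
          \sum_(e | dst e == v) f e = \sum_(e | src e == v) f e,
        separates s t X,
        forall Y, separates s t Y ->
          cut_weight src dst c X <= cut_weight src dst c Y &
        \sum_(e | dst e == t) f e - \sum_(e | src e == t) f e =
          cut_weight src dst c X].
Proof.
move=> st c0.
have s0 : separates s t [set s] by rewrite /separates !inE eqxx eq_sym.
case: (@arg_minP _ _ _ [set s] (separates s t) (cut_weight src dst c) s0) => X sX minX.
have [f tf fc] := tighten c0 minX.
exists f, X; have [f0 fm _] := tf.
have cons v : v != s -> v != t ->
    \sum_(e | dst e == v) f e = \sum_(e | src e == v) f e.
  move=> vs vt; apply/eqP; rewrite eq_le (tight_in_le_out tf vt).
  exact: tight_in_le_out (tight_rev tf) vs.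
split=> // [e|]; first by rewrite f0 fc.
have fX : cut_weight src dst f X = cut_weight src dst c X.
  apply/eqP; rewrite eq_le fm// andbT.
  by rewrite /cut_weight; apply: ler_sum.
have /andP[sX1 tX] := sX.
have sumE (g : E -> W) : \sum_(v | v \notin X) \sum_(e | g e == v) f e =
    \sum_(e | g e \notin X) f e.
  rewrite [RHS](partition_big g (fun v => v \notin X))//=.
  apply: eq_bigr => v vX; apply: eq_bigl => e.
  by case: eqP => [->|]; rewrite ?vX ?andbF.
(* By conservation the net inflows of the nodes outside [X] add up to that of [t]. Regrouped by arcs
   they give the weight of [X], as no flow returns into [X]. *)
transitivity (\sum_(v | v \notin X)
    (\sum_(e | dst e == v) f e - \sum_(e | src e == v) f e)).
  rewrite [RHS](bigD1 t)//= [X in _ = _ + X]big1 ?addr0// => v /andP[vX vt].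
  rewrite cons ?subrr//; apply: contraNneq vX => ->; exact: sX1.
rewrite -fX sumrB !sumE cut_weightE big_mkcond [X in _ - X]big_mkcond -sumrB.
apply: eq_bigr => e _.
have := tight_no_return tf sX fX (e := e); rewrite /crosses.
by case: (src e \in X); case: (dst e \in X) => /= H; try rewrite (H isT); lra.
Qed.

End StaticNetwork.

(** * Time edges and node labels *)

Section TemporalNetwork.
Variables (R : realType) (V : finType) (N : temporal_network R V).
Implicit Types (f : V * V -> nat -> R) (F : pre_flow R V).
Implicit Types (v : V) (S : {fset V * V * nat}).

Lemma mem_time_edges e l :
  ((e, l) \in time_edges N) = (e \in edges N) && (l \in labels N e).
Proof.
apply/bigfcupP/andP => [[e' /andP[_ eE] /imfsetP[l' /= lL [-> ->]]] //|[eE lL]].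
exists e; first by rewrite mem_index_enum eE.
by apply/imfsetP; exists l.
Qed.

Lemma time_edges_gt0 e l : (e, l) \in time_edges N -> (0 < l)%N.
Proof. by rewrite mem_time_edges => /andP[]; exact: labels_gt0. Qed.

Lemma time_edges_le_max e l : (e, l) \in time_edges N -> (l <= max_label N)%N.
Proof.
by move=> eT; apply: (@leq_bigmax_seq _ _ xpredT (fun x => x.2) (e, l)).
Qed.

Lemma node_labels0 v : 0%N \in node_labels N v.
Proof. by rewrite !inE eqxx. Qed.

Lemma mem_node_labels v e l : e \in edges N -> (e.1 == v) || (e.2 == v) ->
  l \in labels N e -> l \in node_labels N v.
Proof.
move=> eE ev lL; rewrite !inE; apply/orP; right.
by apply/bigfcupP; exists e; rewrite // mem_index_enum eE.
Qed.

Lemma mem_last_label v d : last_label N v d \in node_labels N v.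
Proof.
rewrite /last_label big_seq_cond.
apply: (big_ind (fun l => l \in node_labels N v)) => [|x y xv yv|x /andP[]//].
  exact: node_labels0.
by rewrite /maxn; case: ifP.
Qed.

Lemma last_label_le v d : (last_label N v d <= d)%N.
Proof. by apply/bigmax_leqP_seq. Qed.

Lemma last_label_id v d : d \in node_labels N v -> last_label N v d = d.
Proof.
move=> dv; apply/eqP; rewrite eqn_leq last_label_le /=.
exact: (@leq_bigmax_seq _ _ (fun k => k <= d)%N id d).
Qed.

Lemma last_labelS v d : d.+1 \notin node_labels N v ->
  last_label N v d.+1 = last_label N v d.
Proof.
move=> dv; rewrite /last_label big_seq_cond [RHS]big_seq_cond.
apply: eq_bigl => k; rewrite leq_eqVlt ltnS.
by case: eqP => //= ->; rewrite (negbTE dv).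
Qed.

Lemma prev_labelS v l : prev_label N v l.+1 = last_label N v l.
Proof. by []. Qed.

(** * Temporal flows in terms of daily buffer contents *)

Definition inflow f v l : R := \sum_(e in edges N | e.2 == v) f e l.
Definition outflow f v l : R := \sum_(e in edges N | e.1 == v) f e l.
(** Defined on every day, not only at node labels, so that inductions can go day by day. Away from
    the source it agrees with [b^+] at node labels ([buf_plus_content]). *)
Definition content f v d : R := \sum_(0 <= l < d.+1) (inflow f v l - outflow f v l).

Lemma contentS f v d :
  content f v d.+1 = content f v d - outflow f v d.+1 + inflow f v d.+1.
Proof. by rewrite /content big_nat_recr //=; lra. Qed.

Lemma flow_off_labels f v l :
  (forall e l, e \in edges N -> l \notin labels N e -> f e l = 0) ->
  l \notin node_labels N v -> inflow f v l = 0 /\ outflow f v l = 0.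
Proof.
move=> f0 lv; split; apply: big1 => e /andP[eE ev]; apply: f0 => //;
  by apply: contra lv; apply: mem_node_labels => //; rewrite ev ?orbT.
Qed.

Lemma flow_label0 f v :
  (forall e l, e \in edges N -> l \notin labels N e -> f e l = 0) ->
  inflow f v 0 = 0 /\ outflow f v 0 = 0.
Proof.
move=> f0; split; apply: big1 => e /andP[eE _]; apply: f0 => //;
  by apply/negP => /(labels_gt0 eE).
Qed.

Lemma content0 f v :
  (forall e l, e \in edges N -> l \notin labels N e -> f e l = 0) ->
  content f v 0 = 0.
Proof. by move=> /(flow_label0 v)[i0 o0]; rewrite /content big_nat1 i0 o0 subrr. Qed.

(** Days outside [node_labels N v] carry no flow at [v], so the content has not changed since the
    last label. *)
Lemma content_last_label f v d :
  (forall e l, e \in edges N -> l \notin labels N e -> f e l = 0) ->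
  content f v (last_label N v d) = content f v d.
Proof.
move=> f0; elim: d => [|d IH].
  by have := last_label_le v 0; rewrite leqn0 => /eqP ->.
have [dv|dv] := boolP (d.+1 \in node_labels N v); first by rewrite last_label_id.
by have [i0 o0] := flow_off_labels f0 dv; rewrite last_labelS// contentS i0 o0 IH; lra.
Qed.

(** Temporal flows with the buffers eliminated: what leaves on a day must be present at the end of
    the day before. *)
Definition feasible f : Prop :=
  [/\ forall e l, e \in edges N -> 0 <= f e l <= cap N e,
      forall e l, e \in edges N -> l \notin labels N e -> f e l = 0 &
      forall v l, v != source N -> outflow f v l.+1 <= content f v l].

Lemma feasible_content_ge0 f v l : feasible f -> v != source N ->
  0 <= content f v l.
Proof.
move=> [fc _ fo] vs; apply: le_trans (fo v l vs).
by apply: sumr_ge0 => e /andP[eE _]; have /andP[] := fc e l.+1 eE.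
Qed.

Lemma buf_plus_content F v l : is_temporal_flow N F -> v != source N ->
  l \in node_labels N v -> buf_plus F v l = (content (flow F) v l)%:E.
Proof.
move=> tF vs; have f0 := flow_unavailable tF.
(* Strong induction, since the previous label may lie several days back. *)
elim/ltn_ind: l => -[|l] IH lv.
  by have [_ _ ->] := buf_day0 tF vs; rewrite content0.
rewrite (buf_plusE tF)// (buf_muE tF)// (buf_minusE tF)// prev_labelS.
rewrite IH ?ltnS ?last_label_le ?mem_last_label// content_last_label//.
by rewrite contentS.
Qed.

Lemma flow_value_content F : is_temporal_flow N F ->
  flow_value N F = (content (flow F) (sink N) (max_label N))%:E.
Proof.
move=> tF; rewrite /flow_value buf_plus_content ?mem_last_label//.
  by rewrite content_last_label//; exact: flow_unavailable tF.
by rewrite eq_sym source_neq_sink.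
Qed.

Lemma temporal_flow_feasible F : is_temporal_flow N F -> feasible (flow F).
Proof.
move=> tF; have f0 := flow_unavailable tF; split=> // [|v l vs].
  exact: flow_cap tF.
have [lv|lv] := boolP (l.+1 \in node_labels N v).
  have [_ /andP[+ _] _] := buf_bounds tF lv.
  rewrite (buf_muE tF)// (buf_minusE tF)// prev_labelS.
  rewrite buf_plus_content ?mem_last_label// content_last_label//.
  by rewrite -EFinB lee_fin subr_ge0.
have [_ ->] := flow_off_labels f0 lv.
rewrite -content_last_label//.
have [_ _ /andP[+ _]] := buf_bounds tF (mem_last_label v l).
by rewrite buf_plus_content ?mem_last_label// lee_fin.
Qed.

Lemma feasible_temporal_flow f : (forall v, buffer_cap N v = +oo%E) ->
  feasible f -> exists2 F, is_temporal_flow N F & flow F = f.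
Proof.
move=> unb ff; have [fc f0 fo] := ff.
have before_ge0 v l : v != source N -> 0 <= content f v l.-1 - outflow f v l.
  move=> vs; case: l => [|l]; last by rewrite subr_ge0 fo.
  by rewrite content0//; have [_ ->] := flow_label0 v f0; rewrite subrr.
(* The source gets infinite buffers on every day. At [l = 0] the index [l.-1] is again [0], where
   the content is zero, as day 0 demands. *)
pose at_source (x : R) v := if v == source N then +oo%E else x%:E.
exists (PreFlow f (fun v l => at_source (content f v l.-1) v)
  (fun v l => at_source (content f v l.-1 - outflow f v l) v)
  (fun v l => at_source (content f v l) v)) => //.
split=> //=; rewrite /at_source.
- by move=> e eE; apply: f0 => //; apply/negP => /(labels_gt0 eE).
- move=> v l _; rewrite unb; case: eqP => [_|/eqP vs]; rewrite ?leey ?le0y//.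
  by rewrite !lee_fin !feasible_content_ge0// before_ge0// !leey.
- by rewrite eqxx.
- move=> v /negbTE ->; have [_ o0] := flow_label0 v f0.
  by rewrite content0// o0 subrr.
- move=> v [//|l] /negbTE -> _ _.
  by rewrite prev_labelS content_last_label.
- by move=> v l /negbTE -> _ _; rewrite -EFinB.
- move=> v [//|l] /negbTE -> _ _.
  by rewrite contentS -EFinD.
Qed.

(** * Cuts, reachability and weak duality *)

Lemma cut_capacityE S n : (S `<=` time_edges N)%fset -> (max_label N < n)%N ->
  cut_capacity N S = \sum_(0 <= l < n) \sum_(e | (e, l) \in S) cap N e.
Proof.
move=> /fsubsetP ST mn.
pose r := [seq (e, l) | l <- index_iota 0 n, e <- enum {: V * V}].
have -> : cut_capacity N S = \sum_(x <- r | x \in S) cap N x.1.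
  rewrite -[RHS]big_filter; apply: perm_big; apply: uniq_perm.
  - exact: fset_uniq.
  - rewrite filter_uniq// allpairs_uniq ?iota_uniq ?enum_uniq//.
    by move=> [? ?] [? ?] _ _ [-> ->].
  move=> [e l]; rewrite mem_filter.
  case: (boolP ((e, l) \in S)) => //= /ST /time_edges_le_max lm.
  symmetry; apply/allpairsP; exists (l, e); split; rewrite ?mem_enum//=.
  by rewrite mem_index_iota /= (leq_ltn_trans lm).
rewrite big_mkcond big_allpairs_dep; apply: eq_bigr => l _.
by rewrite big_enum -big_mkcond.
Qed.

Lemma sum_outflow f (A : {set V}) l :
  \sum_(v | v \notin A) outflow f v l = \sum_(e in edges N | e.1 \notin A) f e l.
Proof.
rewrite [RHS](partition_big fst (fun v => v \notin A)) => [|e /andP[]//].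
apply: eq_bigr => v vA; apply: eq_bigl => e.
by case: eqP => [->|]; rewrite ?vA ?andbT ?andbF.
Qed.

Lemma sum_inflow f (A : {set V}) l :
  \sum_(v | v \notin A) inflow f v l = \sum_(e in edges N | e.2 \notin A) f e l.
Proof.
rewrite [RHS](partition_big snd (fun v => v \notin A)) => [|e /andP[]//].
apply: eq_bigr => v vA; apply: eq_bigl => e.
by case: eqP => [->|]; rewrite ?vA ?andbT ?andbF.
Qed.

(** The source and the nodes that journeys avoiding [S] reach by day [d]. Tails are taken from the
    day before, which makes labels strictly increase. *)
Fixpoint reached S d : {set V} :=
  if d is d'.+1 then
    reached S d' :|: [set e.2 | e : V * V &
      ((e, d) \in (time_edges N `\` S)%fset) && (e.1 \in reached S d')]
  else [set source N].

(** The bound on the last label lets the journey be extended by a time edge of the next day. *)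
Lemma reached_journey S d v : v \in reached S d -> v != source N ->
  exists x q, journey (time_edges N `\` S)%fset (source N) v (x :: q) /\
    ((last x q).2 <= d)%N.
Proof.
elim: d v => [v|d IH v]; rewrite !inE; first by move=> ->.
move=> /orP[vd vs|/imsetP[e + ->] _]; last rewrite inE => /andP[eT er].
  by have [x [q [j l]]] := IH v vd vs; exists x, q; split => //; exact: leqW.
have [es|es] := eqVneq e.1 (source N).
  by exists (e, d.+1), [::]; split=> //=; rewrite eT es !eqxx.
have [x [q [/= /and4P[/andP[xT qT] xs /eqP lq pq] l]]] := IH _ er es.
exists x, (rcons q (e, d.+1)); split; last by rewrite last_rcons.
by rewrite /= all_rcons rcons_path last_rcons xT qT eT xs pq lq !eqxx /= ltnS l.
Qed.

(* Day by day, the flow held outside the nodes reached while avoiding S grows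
   by at most the capacity of the time edges of S available that day. *)
Lemma weak_duality f S : feasible f -> temporal_cut N S ->
  content f (sink N) (max_label N) <= cut_capacity N S.
Proof.
move=> ff [ST noj]; have [fc f0 fo] := ff.
have TS e l : (e, l) \in S -> e \in edges N.
  by move=> /(fsubsetP ST); rewrite mem_time_edges => /andP[].
have s_reached d : source N \in reached S d.
  by elim: d => [|d IH] /=; rewrite !inE ?eqxx// IH.
have main d : \sum_(v | v \notin reached S d) content f v d <=
    \sum_(0 <= l < d.+1) \sum_(e | (e, l) \in S) cap N e.
  elim: d => [|d IH].
    rewrite big1 => [|v _]; last exact: content0.
    apply: sumr_ge0 => l _; apply: sumr_ge0 => e /TS eE; exact/ltW/cap_gt0.
  rewrite big_nat_recr//=.
  (* Reached sets only grow, and a newly reached node removes a nonnegative term. *)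
  have : \sum_(v | v \notin reached S d.+1) content f v d.+1 <=
      \sum_(v | v \notin reached S d) (content f v d - outflow f v d.+1) +
      \sum_(v | v \notin reached S d.+1) inflow f v d.+1.
    under eq_bigr do rewrite contentS.
    rewrite big_split lerD2r big_mkcond [leRHS]big_mkcond.
    apply: ler_sum => v _; rewrite [in X in X <= _]inE.
    have [vr|vr] //= := boolP (v \in reached S d).
    have vs : v != source N by apply: contraNneq vr => ->.
    by case: ifP => _ //; rewrite subr_ge0 fo.
  rewrite sumrB sum_outflow sum_inflow.
  suff : \sum_(e in edges N | e.2 \notin reached S d.+1) f e d.+1 <=
      \sum_(e in edges N | e.1 \notin reached S d) f e d.+1 +
      \sum_(e | (e, d.+1) \in S) cap N e by lra.
  (* Edge by edge: flow from an unreached tail was already outside, flow on [S] is paid for by its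
     capacity, and any other available edge has a reached head. *)
  rewrite big_mkcond [X in _ <= X + _]big_mkcond [X in _ <= _ + X]big_mkcond.
  rewrite -big_split; apply: ler_sum => e _ /=.
  have [eE|eE] /= := boolP (e \in edges N); last first.
    by case: ifP => [/TS|]; rewrite ?(negbTE eE) ?addr0.
  have c0 := cap_gt0 eE; have /andP[fe0 fec] := fc e d.+1 eE.
  have [e1|e1] /= := boolP (e.1 \in reached S d); last by case: ifP; case: ifP; lra.
  case: (boolP ((e, d.+1) \in S)) => [_|eS]; first by case: ifP; lra.
  case: ifPn => [|_]; last by lra.
  rewrite inE negb_or => /andP[_ e2]; rewrite f0; [lra|by []|].
  apply: contra e2 => lL; apply/imsetP; exists e => //.
  by rewrite inE in_fsetD eS mem_time_edges eE lL.
rewrite (cut_capacityE ST (ltnSn _)); apply: le_trans (main _).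
have ts : sink N != source N by rewrite eq_sym source_neq_sink.
(* The sink is never reached because [S] is a cut. *)
rewrite (bigD1 (sink N)) /=; last first.
  apply/negP => /reached_journey -/(_ ts)[x [q [j _]]].
  by apply: noj; exists (x :: q).
rewrite lerDl; apply: sumr_ge0 => v /andP[vr _]; apply: feasible_content_ge0 => //.
by apply: contraNneq vr => ->.
Qed.

(** Induction along the journey: labels strictly increase, so what holds at the previous label holds
    by monotonicity at [l.-1]. *)
Lemma journey_closed (A : {fset V * V * nat}) (P : V -> nat -> bool) u v p :
  journey A u v p ->
  (forall v n m, (n <= m)%N -> P v n -> P v m) ->
  (forall e l, (e, l) \in A -> P e.1 l.-1 -> P e.2 l) ->
  P u 0%N -> exists l, P v l.
Proof.
case: p => // x q /and4P[/= /andP[xA qA] /eqP xu /eqP <- pq] mono step Pu.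
have {Pu xu xA} Px : P x.1.2 x.2.
  case: x xA xu {pq qA} => e l /= eA eu; apply: step => //.
  by apply: mono (leq0n _) _; rewrite eu.
elim: q x Px qA pq => [|[e l] q IH] x Px /=; first by exists x.2.
move=> /andP[eA qA] /andP[/andP[/eqP ex lx] pq].
apply: (IH (e, l)) => //=; apply: step => //; rewrite -ex; apply: mono Px.
by rewrite -ltnS prednK//; exact: leq_ltn_trans lx.
Qed.

End TemporalNetwork.

(** * The time-expanded static network *)

Section TimeExpansion.
Variables (R : realType) (V : finType) (N : temporal_network R V).

(** One day past the last label, with no time edge: flow enters the last copy of the sink only by
    its holding arc. *)
Let D := (max_label N).+1.
Let node := (V * 'I_D.+1)%type.
(* [inl (e, d)] is the time edge (e, d + 1); [inr (v, d)] holds flow in the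
   buffer of v from day d to day d + 1. *)
Let arc := (V * V * 'I_D + V * 'I_D)%type.

(** [widen_ord] keeps the day [d] and [lift ord0] makes it [d + 1], so every arc takes one day. *)
Definition arc_src (a : arc) : node :=
  match a with
  | inl (e, d) => (e.1, widen_ord (leqnSn D) d)
  | inr (v, d) => (v, widen_ord (leqnSn D) d)
  end.

Definition arc_dst (a : arc) : node :=
  match a with
  | inl (e, d) => (e.2, lift ord0 d)
  | inr (v, d) => (v, lift ord0 d)
  end.

(* Holding arcs are more expensive than all time edges together, hence in no
   minimum cut. *)
Definition arc_cap (a : arc) : R :=
  match a with
  | inl (e, d) => if (e, d.+1) \in time_edges N then cap N e else 0
  | inr _ => cut_capacity N (time_edges N) + 1
  end.

(** Reads [g d] at the label [d + 1] and gives [0] at all other labels; the sum avoids casts to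
    ordinals and covers both border days. *)
Definition on_day (g : 'I_D -> R) (l : nat) : R := \sum_(d < D | d.+1 == l) g d.

Lemma on_dayE g (d : 'I_D) : on_day g d.+1 = g d.
Proof. by rewrite /on_day (big_pred1 d)// => i; rewrite eqSS. Qed.

Lemma on_day_late g l : (D < l)%N -> on_day g l = 0.
Proof. by move=> Dl; apply: big_pred0 => d; apply: ltn_eqF; exact: leq_ltn_trans Dl. Qed.

Lemma cap_ge0 e : e \in edges N -> 0 <= cap N e.
Proof. by move=> eE; apply/ltW/cap_gt0. Qed.

Lemma cut_capacity_days S : (S `<=` time_edges N)%fset ->
  cut_capacity N S = \sum_(d < D) \sum_(e | (e, d.+1) \in S) cap N e.
Proof.
move=> ST; rewrite (@cut_capacityE _ _ _ _ D.+1)//.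
rewrite big_mkord big_ord_recl big_pred0 ?add0r// => e.
by apply/negP => /(fsubsetP ST)/time_edges_gt0.
Qed.

(** * From static flows to temporal flows *)

Section Flow.
Variable g : arc -> R.
Hypothesis g_cap : forall a, 0 <= g a <= arc_cap a.

Definition day_flow e l : R := on_day (fun d => g (inl (e, d))) l.
(** Indexed by the day on which the holding arc ends. *)
Definition hold v l : R := on_day (fun d => g (inr (v, d))) l.

Lemma day_flow_cap e l : e \in edges N -> 0 <= day_flow e l <= cap N e.
Proof.
move=> eE; case: l => [|l]; first by rewrite /day_flow /on_day big_pred0// lexx cap_ge0.
have [lD|lD] := ltnP l D; last by rewrite /day_flow on_day_late// lexx cap_ge0.
rewrite /day_flow (on_dayE _ (Ordinal lD)).
have /andP[-> /= gc] := g_cap (inl (e, Ordinal lD)); apply: le_trans gc _.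
by case: ifP => // _; exact: cap_ge0.
Qed.

Lemma day_flow0 e l : (e, l) \notin time_edges N -> day_flow e l = 0.
Proof.
move=> eT; apply: big1 => d /eqP dl; apply/eqP; rewrite eq_le.
have := g_cap (inl (e, d)).
by rewrite /= dl (negbTE eT) andbC.
Qed.

Lemma day_flow_edge e l : e \notin edges N -> day_flow e l = 0.
Proof. by move=> eE; apply: day_flow0; rewrite mem_time_edges negb_and eE. Qed.

Lemma hold_ge0 v l : 0 <= hold v l.
Proof. by apply: sumr_ge0 => d _; have /andP[] := g_cap (inr (v, d)). Qed.

Lemma arcs_in v (d : 'I_D.+1) :
  \sum_(a | arc_dst a == (v, d)) g a = inflow N day_flow v d + hold v d.
Proof.
rewrite big_sumType /=; congr (_ + _).
  rewrite /inflow /day_flow [RHS]big_mkcondl /=.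
  rewrite [RHS](eq_bigr (fun e => on_day (fun d => g (inl (e, d))) d)); last first.
    by move=> e _; case: ifPn => // eE; apply/esym/(day_flow_edge _ eE).
  by rewrite /on_day [RHS]pair_big; apply: eq_big => -[].
rewrite /hold /on_day.
transitivity (\sum_(u | u == v) \sum_(i < D | i.+1 == d :> nat) g (inr (u, i))).
  by rewrite [RHS]pair_big; apply: eq_big => -[].
by rewrite big_pred1_eq.
Qed.

Lemma arcs_out v (d : 'I_D.+1) :
  \sum_(a | arc_src a == (v, d)) g a = outflow N day_flow v d.+1 + hold v d.+1.
Proof.
rewrite big_sumType /=; congr (_ + _).
  rewrite /outflow /day_flow [RHS]big_mkcondl /=.
  rewrite [RHS](eq_bigr (fun e => on_day (fun d => g (inl (e, d))) d.+1)); last first.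
    by move=> e _; case: ifPn => // eE; apply/esym/(day_flow_edge _ eE).
  by rewrite /on_day [RHS]pair_big; apply: eq_big => -[].
rewrite /hold /on_day.
transitivity (\sum_(u | u == v) \sum_(i < D | i.+1 == d.+1 :> nat) g (inr (u, i))).
  by rewrite pair_big; apply: eq_big => -[].
by rewrite big_pred1_eq.
Qed.

Hypothesis g_conserved : forall x : node, x != (source N, ord0) ->
  x != (sink N, ord_max) ->
  \sum_(a | arc_dst a == x) g a = \sum_(a | arc_src a == x) g a.

(** Conservation at each daily copy of [v]: what is present either leaves on the next day or is
    held. On day 0 nothing has arrived. *)
Lemma content_hold v d : v != source N -> (d < D)%N ->
  content N day_flow v d = outflow N day_flow v d.+1 + hold v d.+1.
Proof.
move=> vs.
have bal n : (n < D)%N -> inflow N day_flow v n + hold v n =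
    outflow N day_flow v n.+1 + hold v n.+1.
  move=> nD; have := @g_conserved (v, Ordinal (ltnW nD : n < D.+1)%N).
  rewrite arcs_in arcs_out /=; apply.
    by rewrite xpair_eqE (negbTE vs).
  by rewrite xpair_eqE negb_and -val_eqE /= (ltn_eqF nD) orbT.
elim: d => [|d IH] dD.
  rewrite content0 => [|e l _ lL]; last first.
    by rewrite day_flow0// mem_time_edges negb_and lL orbT.
  rewrite -bal// /hold /on_day [X in _ + X]big_pred0// addr0.
  rewrite /inflow big1// => e _; rewrite day_flow0//.
  by apply/negP => /time_edges_gt0.
by have := IH (ltnW dD); have := bal _ dD; rewrite contentS => <- ->; lra.
Qed.

Lemma day_flow_feasible : feasible N day_flow.
Proof.
split=> [e l eE|e l eE lL|v l vs].
- exact: day_flow_cap.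
- by rewrite day_flow0// mem_time_edges eE.
elim: l => [|l IH]; first by rewrite content_hold// lerDl hold_ge0.
have [lD|lD] := ltnP l.+1 D; first by rewrite content_hold// lerDl hold_ge0.
(* Beyond day [D] nothing leaves, and by induction the content stays nonnegative. *)
rewrite contentS {1}/outflow big1 => [|e _]; last by rewrite /day_flow on_day_late.
rewrite addr_ge0 ?subr_ge0//; apply: sumr_ge0 => e /andP[eE _].
by have /andP[] := day_flow_cap l.+1 eE.
Qed.

(** Nothing leaves the sink, so its whole content lies on the last holding arc. *)
Lemma content_sink : content N day_flow (sink N) (max_label N) =
  \sum_(a | arc_dst a == (sink N, ord_max)) g a -
  \sum_(a | arc_src a == (sink N, ord_max)) g a.
Proof.
have o0 l : outflow N day_flow (sink N) l = 0.
  rewrite /outflow big_pred0// => -[u w] /=; apply/negP => /andP[eE /eqP us].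
  by move: eE; rewrite us; apply/negP/sink_no_out.
rewrite content_hold ?ltnSn// 1?eq_sym ?source_neq_sink//.
rewrite arcs_in arcs_out !o0 /= /inflow big1 => [|e _]; last first.
  by apply: day_flow0; apply/negP => /time_edges_le_max; rewrite ltnn.
by rewrite [hold _ D.+1]on_day_late//; lra.
Qed.

End Flow.

(** * From minimum static cuts to temporal cuts *)

Section Cut.
Variable X : {set node}.
Hypothesis X_sep : separates (source N, ord0) (sink N, ord_max) X.
Hypothesis X_min : forall Y, separates (source N, ord0) (sink N, ord_max) Y ->
  cut_weight arc_src arc_dst arc_cap X <= cut_weight arc_src arc_dst arc_cap Y.

Lemma arc_cap_ge0 a : 0 <= arc_cap a.
Proof.
case: a => [[e d]|_] /=.
  by case: ifP => //; rewrite mem_time_edges => /andP[/cap_ge0].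
rewrite addr_ge0// /cut_capacity big_seq; apply: sumr_ge0 => -[e l].
by rewrite mem_time_edges => /andP[/cap_ge0].
Qed.

Lemma no_hold_crosses v d : ~~ crosses arc_src arc_dst X (inr (v, d)).
Proof.
apply/negP => cr.
(* The competing cut consists of all copies of the source. No holding arc crosses it, so it weighs
   at most the capacity of all time edges. *)
have sY : separates (source N, ord0) (sink N, ord_max) [set x : node | x.1 == source N].
  by rewrite /separates !inE eqxx /= eq_sym source_neq_sink.
have := X_min sY; apply/negP; rewrite -ltNge.
have lt : cut_capacity N (time_edges N) < arc_cap (inr (v, d)) by rewrite /= ltrDl.
apply: le_lt_trans (lt_le_trans lt _); last first.
  by rewrite /cut_weight (bigD1 (inr (v, d)))//= lerDl sumr_ge0// => a _; exact: arc_cap_ge0.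
rewrite cut_weightE big_sumType /= [X in _ + X]big1 => [|[u i] _]; last first.
  by rewrite /crosses !inE /=; case: (u == _).
rewrite addr0 cut_capacity_days//.
under [leRHS]eq_bigr do rewrite big_mkcond.
rewrite [leRHS]exchange_big [leRHS]pair_big /=; apply: ler_sum => -[e i] _ /=.
have := arc_cap_ge0 (inl (e, i)); rewrite /=.
by case: ifP => //; case: ifP.
Qed.

Lemma X_mono v (i j : 'I_D.+1) : (i <= j)%N -> (v, i) \in X -> (v, j) \in X.
Proof.
move=> ij iX; case: j ij; elim=> [|j IH] jD ij.
  by have -> : Ordinal jD = i by apply: val_inj; move: ij; rewrite leqn0 => /eqP.
have [ji|ji] := leqP i j; last first.
  have -> // : Ordinal jD = i by apply: val_inj; apply/eqP; rewrite eqn_leq ij ji.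
have jX := IH (ltnW jD) ji.
have := no_hold_crosses v (Ordinal (jD : j < D)%N); rewrite /crosses /= negb_and negbK.
have -> : widen_ord (leqnSn D) (Ordinal (jD : j < D)%N) = Ordinal (ltnW jD) by apply: val_inj.
rewrite jX /=; congr ((v, _) \in X); exact: val_inj.
Qed.

(** Membership in [X] extended to all natural days and monotone by construction, as [journey_closed]
    requires. *)
Definition by_day v n := [exists i : 'I_D.+1, (i <= n)%N && ((v, i) \in X)].

Lemma by_dayP v (i : 'I_D.+1) : by_day v i = ((v, i) \in X).
Proof.
apply/existsP/idP => [[j /andP[]]|iX]; first exact: X_mono.
by exists i; rewrite leqnn.
Qed.

Lemma by_day_mono v n m : (n <= m)%N -> by_day v n -> by_day v m.
Proof.
move=> nm /existsP[i /andP[ni iX]]; apply/existsP; exists i.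
by rewrite iX (leq_trans ni).
Qed.

Definition crossing_edges : {fset V * V * nat} :=
  [fset x in time_edges N | by_day x.1.1 x.2.-1 && ~~ by_day x.1.2 x.2]%fset.

(** A journey avoiding these edges stays in [by_day], so it would put some copy of the sink in [X],
    and by [X_mono] also the last one. *)
Lemma crossing_edges_cut : temporal_cut N crossing_edges.
Proof.
have /andP[sX tX] := X_sep.
split; first by apply/fsubsetP => x; rewrite !inE => /andP[].
move=> [p /(@journey_closed _ _ by_day)[]].
- exact: by_day_mono.
- by move=> e l; rewrite !inE /= => /andP[+ eT] es; rewrite eT es /= negbK.
- by have := by_dayP (source N) ord0; rewrite sX.
move=> l /existsP[i /andP[_ iX]]; move/negP: tX; apply.
by apply: X_mono iX; rewrite -ltnS.
Qed.

(** Each of these time edges has its own arc of equal capacity crossing [X]. *)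
Lemma crossing_edges_capacity :
  cut_capacity N crossing_edges <= cut_weight arc_src arc_dst arc_cap X.
Proof.
have [ST _] := crossing_edges_cut.
rewrite cut_capacity_days// cut_weightE big_sumType /=.
apply: ler_wpDr.
  by apply: sumr_ge0 => a _; case: ifP => // _; exact: (arc_cap_ge0 (inr a)).
under [leLHS]eq_bigr do rewrite big_mkcond.
rewrite [leLHS]exchange_big [leLHS]pair_big /=; apply: ler_sum => -[e i] _ /=.
have a0 := arc_cap_ge0 (inl (e, i)).
case: ifP => [|_]; last by case: ifP.
rewrite !inE /= => /and3P[eT ei].
have := by_dayP e.2 (lift ord0 i); rewrite lift0 => -> ei'.
have := by_dayP e.1 (widen_ord (leqnSn D) i); rewrite /= ei => eiX.
by rewrite /crosses /= -eiX ei' eT.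
Qed.

End Cut.

Theorem max_temporal_flow_min_cut : (forall v, buffer_cap N v = +oo%E) ->
  exists F S, [/\ is_temporal_flow N F, temporal_cut N S &
    flow_value N F = (cut_capacity N S)%:E].
Proof.
move=> unb.
have st : (source N, ord0) != (sink N, ord_max) :> node.
  by rewrite xpair_eqE negb_and source_neq_sink.
have [g [X [gc gcons sX minX gX]]] := max_flow_min_cut arc_src arc_dst st arc_cap_ge0.
have ff := day_flow_feasible gc gcons.
have [F tF Ff] := feasible_temporal_flow unb ff.
have cS := crossing_edges_cut sX minX.
exists F, (crossing_edges X); split=> //.
rewrite flow_value_content// Ff; congr _%:E; apply/eqP; rewrite eq_le.
(* The converse of weak duality: the value is the weight of [X], which is at least the capacity of
   the temporal cut. *)
rewrite weak_duality//= content_sink// gX.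
exact: crossing_edges_capacity.
Qed.

End TimeExpansion.

(** * Attainment of the maximum and of both minima *)

Local Open Scope classical_set_scope.

Theorem theorem1 (R : realType) (V : finType) (N : temporal_network R V)
    (unbounded : forall v : V, buffer_cap N v = +oo%E) :
  exists m : R,
    [/\ is_maximum [set flow_value N f | f in is_temporal_flow N] m%:E%E,
        is_minimum [set cut_capacity N S | S in temporal_cut N] m &
        is_minimum [set cut_capacity N S | S in minimal_temporal_cut N] m].
Proof.
have [F [S [tF cS FS]]] := max_temporal_flow_min_cut unbounded.
have duality F' S' : is_temporal_flow N F' -> temporal_cut N S' ->
    (flow_value N F' <= (cut_capacity N S')%:E)%E.
  move=> tF' cS'; rewrite flow_value_content// lee_fin.
  exact: weak_duality (temporal_flow_feasible tF') cS'.
have min S' : temporal_cut N S' -> cut_capacity N S <= cut_capacity N S'.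
  by move=> cS'; rewrite -lee_fin -FS duality.
exists (cut_capacity N S); split; split.
- by exists F.
- by move=> _ [F' tF' <-]; exact: duality.
- by exists S.
- by move=> _ [S' cS' <-]; exact: min.
(* Capacities are positive, so a cut of minimum capacity is minimal: deleting a time edge outside
   [S'] would leave a cheaper set that still contains [S'], hence a cut. *)
- exists S => //; split=> // S' S'S cS'.
  have [ST _] := cS; have /andP[/fsubsetP S'sub /fsubsetPn[[e l] eS eS']] := S'S.
  have eE : e \in edges N.
    by move: (fsubsetP ST _ eS); rewrite mem_time_edges => /andP[].
  have : temporal_cut N (S `\ (e, l))%fset.
    split; first exact: fsubset_trans (fsubD1set _ _) ST.
    move=> [p jp]; apply: (proj2 cS'); exists p.
    case: p jp => // x q /and4P[/allP xq xs xt pq]; apply/and4P; split=> //.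
    apply/allP => y /xq; rewrite !in_fsetD in_fset1 negb_and negbK => /andP[+ ->].
    rewrite andbT => /orP[/eqP -> //|]; apply: contra; exact: S'sub.
  move=> /min; rewrite [X in X <= _ -> _]/cut_capacity (big_fsetD1 _ eS) /=.
  by rewrite gerDr leNgt cap_gt0.
- by move=> _ [S' [cS' _] <-]; exact: min.
Qed.
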